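(* The factor ring $\mathcal{F}({}^*\mathbb{C})/\mathcal{I}({}^*\mathbb{C})$ is field isomorphic to $\mathbb{C}$ under $[z]\mapsto \mathrm{st}(z)$. Similarly, $\mathcal{F}({}^*\mathbb{R})/\mathcal{I}({}^*\mathbb{R})$ is order field isomorphic to $\mathbb{R}$ under $[x]\mapsto\mathrm{st}(x)$.
   Context: $\mathbb{R}_+$ is the set of positive real numbers and $\mathbb{N}=\{1,2,3,\dots\}$. Fix an ultrafilter $\mathcal{U}$ on $\mathbb{R}_+$ such that $(0,\tfrac1n)\in\mathcal{U}$ for all $n\in\mathbb{N}$. A property of $\varepsilon\in\mathbb{R}_+$ holds almost everywhere (a.e.) if the set of $\varepsilon$ for which it holds belongs to $\mathcal{U}$. For nets $(a_\varepsilon),(b_\varepsilon)\in\mathbb{C}^{\mathbb{R}_+}$ write $(a_\varepsilon)\sim(b_\varepsilon)$ if $a_\varepsilon=b_\varepsilon$ a.e.; $\langle a_\varepsilon\rangle$ is the equivalence class, and ${}^*\mathbb{C}=\mathbb{C}^{\mathbb{R}_+}/\!\sim$ with operations induced pointwise (a field). $\mathbb{C}$ is embedded in ${}^*\mathbb{C}$ via constant nets. ${}^*\mathbb{R}=\{\langle a_\varepsilon\rangle : a_\varepsilon\in\mathbb{R}\text{ a.e.}\}$, ordered by $\langle a_\varepsilon\rangle<\langle b_\varepsilon\rangle$ iff $a_\varepsilon<b_\varepsilon$ a.e.; every $z\in{}^*\mathbb{C}$ is uniquely $z=x+iy$ with $x,y\in{}^*\mathbb{R}$; $|\langle z_\varepsilon\rangle|=\langle|z_\varepsilon|\rangle$.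 For $\mathbb{K}={}^*\mathbb{C}$ or ${}^*\mathbb{R}$: $\mathcal{F}(\mathbb{K})=\{z\in\mathbb{K}: |z|\le n\text{ for some }n\in\mathbb{N}\}$ is the ring of finite numbers and $\mathcal{I}(\mathbb{K})=\{z\in\mathbb{K}:|z|<\tfrac1n\text{ for all }n\in\mathbb{N}\}$ is the ideal of infinitesimals in $\mathcal{F}(\mathbb{K})$. $[z]$ denotes the coset of $z$ modulo the infinitesimals. For $x\in\mathcal{F}({}^*\mathbb{R})$, $\mathrm{st}(x)=\sup\{r\in\mathbb{R}: r\le x\}\in\mathbb{R}$; for $x+iy\in\mathcal{F}({}^*\mathbb{C})$, $\mathrm{st}(x+iy)=\mathrm{st}(x)+i\,\mathrm{st}(y)$. The order on $\mathcal{F}({}^*\mathbb{R})/\mathcal{I}({}^*\mathbb{R})$ is the quotient order by the convex ideal $\mathcal{I}({}^*\mathbb{R})$: $[x]<[y]$ iff $x<y$ and $x-y\notin\mathcal{I}({}^*\mathbb{R})$. *)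

(* Defs.v *)
From HB Require Import structures.
From mathcomp Require Import all_boot all_order all_algebra.
From mathcomp Require Import interval_inference.
From mathcomp Require Import boolp classical_sets functions filter reals.
From mathcomp Require Import complex ring lra.

Set Implicit Arguments.
Unset Strict Implicit.
Unset Printing Implicit Defensive.

Import Order.TTheory GRing.Theory Num.Theory.

Local Open Scope ring_scope.
Local Open Scope quotient_scope.
Local Open Scope classical_set_scope.
Local Open Scope complex_scope.


(* pointedness makes the pointwise ring of nets over {posnum R} nontrivial *)
HB.instance Definition _ (R : numDomainType) := Choice.on {posnum R}.
HB.instance Definition _ (R : numFieldType) := isPointed.Build {posnum R} 1%:pos.

Section Ultrapower.
Variables (T : pointedType) (K : numFieldType) (U : set_system T).
Hypothesis HU : UltraFilter U.

Implicit Types a b : T -> K.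

Definition null_net : {pred T -> K} := fun a => `[< \forall e \near U, a e = 0 >].

Lemma null_net_ideal : idealr_closed null_net.
Proof.
split.
- by apply/asboolP; apply: filterE.
- apply/asboolP => U1; have [e /eqP] := filter_ex U1.
  by rewrite [X in X == _]/(1 : K) oner_eq0.
- move=> a u v /asboolP u0 /asboolP v0; apply/asboolP.
  near=> e; change (a e * u e + v e = 0).
  by rewrite (near u0 e) // (near v0 e) // mulr0 addr0.
Unshelve. all: by end_near. Qed.

HB.instance Definition _ := isIdealr.Build (T -> K) null_net null_net_ideal.

(* quotienting by the ideal of nets that vanish a.e. is quotienting by a.e.
   equality, see ulim_eq *)
Definition ultrapower : Type := {ideal_quot null_net}.

HB.instance Definition _ := GRing.ComNzRing.on ultrapower.
HB.instance Definition _ := NzRingQuotient.on ultrapower.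

Definition ulim (a : T -> K) : ultrapower := \pi_ultrapower a.

Lemma ulim_repr (z : ultrapower) : ulim (repr z) = z.
Proof. exact: reprK. Qed.

Lemma ulimP (z : ultrapower) : exists a, z = ulim a.
Proof. by exists (repr z); rewrite ulim_repr. Qed.

Lemma ulim_eq a b : ulim a = ulim b <-> \forall e \near U, a e = b e.
Proof.
have E : (ulim a == ulim b) = ((a - b) \in null_net) by rewrite Quotient.idealrBE.
split=> [/eqP|H].
  rewrite E => /asboolP; apply: filterS => e He; apply/eqP.
  by rewrite -subr_eq0; apply/eqP.
apply/eqP; rewrite E; apply/asboolP; move: H; apply: filterS => e He.
by change (a e - b e = 0); rewrite He subrr.
Qed.

Lemma ulimD a b : ulim a + ulim b = ulim (fun e => a e + b e).
Proof. by rewrite /ulim -rmorphD. Qed.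

Lemma ulimN a : - ulim a = ulim (fun e => - a e).
Proof. by rewrite /ulim -rmorphN. Qed.

Lemma ulimM a b : ulim a * ulim b = ulim (fun e => a e * b e).
Proof. by rewrite /ulim -rmorphM. Qed.

Lemma ulim0 : 0 = ulim (fun=> 0).
Proof. by rewrite /ulim -[LHS](rmorph0 \pi_ultrapower). Qed.

Lemma ulim1 : 1 = ulim (fun=> 1).
Proof. by rewrite /ulim -[LHS](rmorph1 \pi_ultrapower). Qed.

Lemma near_repr a : \forall e \near U, repr (ulim a) e = a e.
Proof. by apply/ulim_eq; rewrite ulim_repr. Qed.

(* this is where U being an ultrafilter, and not only a filter, matters *)
Lemma nearN (P : set T) : ~ (\near U, P U) -> \forall e \near U, ~ P e.
Proof. by have [//|] := in_ultra_setVsetC P HU. Qed.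

Definition uinv (z : ultrapower) : ultrapower := ulim (fun e => (repr z e)^-1).

Lemma uinvE a : uinv (ulim a) = ulim (fun e => (a e)^-1).
Proof. by apply/ulim_eq; apply: filterS (near_repr a) => e ->. Qed.

Lemma umulVr (z : ultrapower) : z != 0 -> uinv z * z = 1.
Proof.
have [a ->] := ulimP z; rewrite uinvE ulimM ulim0 ulim1 => /eqP az.
apply/ulim_eq; have /nearN : ~ (\forall e \near U, a e = 0) by move/ulim_eq/az.
by apply: filterS => e /eqP ae; rewrite mulVf.
Qed.

Lemma uinv0 : uinv 0 = 0.
Proof.
by rewrite ulim0 uinvE; apply/ulim_eq; apply: filterE => e; rewrite invr0.
Qed.

HB.instance Definition _ := GRing.ComNzRing_isField.Build ultrapower umulVr uinv0.

(* Over K = R[i], whose order compares only numbers with equal imaginary parts,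
   these are partial orders; both the relations and the norm |<a_e>| = <|a_e|>
   are independent of the chosen representatives (uleE, ultE, unormE). *)
Definition ule (z w : ultrapower) := `[< \forall e \near U, repr z e <= repr w e >].
Definition ult (z w : ultrapower) := `[< \forall e \near U, repr z e < repr w e >].
Definition unorm (z : ultrapower) : ultrapower := ulim (fun e => `|repr z e|).

Lemma uleE a b : ule (ulim a) (ulim b) = `[< \forall e \near U, a e <= b e >].
Proof.
apply/asboolP/asboolP;
  by move: (near_repr a) (near_repr b); apply: filterS3 => e -> ->.
Qed.

Lemma ultE a b : ult (ulim a) (ulim b) = `[< \forall e \near U, a e < b e >].
Proof.
apply/asboolP/asboolP;
  by move: (near_repr a) (near_repr b); apply: filterS3 => e -> ->.
Qed.

Lemma unormE a : unorm (ulim a) = ulim (fun e => `|a e|).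
Proof. by apply/ulim_eq; apply: filterS (near_repr a) => e ->. Qed.

Lemma unormD z w : ule (unorm (z + w)) (unorm z + unorm w).
Proof.
have [a ->] := ulimP z; have [b ->] := ulimP w.
rewrite ulimD !unormE ulimD uleE; apply/asboolP; apply: filterE => e.
exact: ler_normD.
Qed.

Lemma ultD z w : ult 0 z -> ult 0 w -> ult 0 (z + w).
Proof.
have [a ->] := ulimP z; have [b ->] := ulimP w.
rewrite ulimD ulim0 !ultE => /asboolP az /asboolP bz; apply/asboolP.
by move: az bz; apply: filterS2 => e; exact: addr_gt0.
Qed.

Lemma unorm_eq0 z : unorm z = 0 -> z = 0.
Proof.
have [a ->] := ulimP z; rewrite unormE ulim0 => /ulim_eq az; apply/ulim_eq.
by apply: filterS az => e /normr0_eq0.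
Qed.

Lemma uge_total z w : ule 0 z -> ule 0 w -> ule z w || ule w z.
Proof.
have [a ->] := ulimP z; have [b ->] := ulimP w.
rewrite ulim0 !uleE => /asboolP a0 /asboolP b0; apply/orP.
have [ab|/nearN ab] := pselect (\forall e \near U, a e <= b e).
  by left; apply/asboolP.
right; apply/asboolP; move: a0 b0 ab; apply: filterS3 => e a0 b0 ab.
by have := ger_leVge a0 b0 => /orP[/ab|].
Qed.

Lemma unormM : {morph unorm : z w / z * w}.
Proof.
move=> z w; have [a ->] := ulimP z; have [b ->] := ulimP w.
rewrite ulimM !unormE ulimM; apply/ulim_eq; apply: filterE => e; exact: normrM.
Qed.

Lemma ule_def z w : ule z w = (unorm (w - z) == w - z).
Proof.
have [a ->] := ulimP z; have [b ->] := ulimP w.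
rewrite ulimN ulimD unormE uleE; apply/asboolP/eqP => [H|/ulim_eq H].
  by apply/ulim_eq; apply: filterS H => e; rewrite ler_def => /eqP.
by apply: filterS H => e /eqP; rewrite -ler_def.
Qed.

Lemma ult_def z w : ult z w = (w != z) && ule z w.
Proof.
have [a ->] := ulimP z; have [b ->] := ulimP w.
rewrite uleE ultE; apply/asboolP/andP => [H|[/eqP ba /asboolP ab]].
  split; last by apply/asboolP; apply: filterS H => e; exact: ltW.
  apply/eqP => /ulim_eq ba; have [e [/= lt_ab E]] := filter_ex (filterI H ba).
  by rewrite E ltxx in lt_ab.
have /nearN nba : ~ \forall e \near U, b e = a e by move/ulim_eq.
by move: nba ab; apply: filterS2 => e /eqP; rewrite lt_def => -> ->.
Qed.

HB.instance Definition _ := Num.IntegralDomain_isNumRing.Build ultrapower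
  unormD ultD unorm_eq0 uge_total unormM ule_def ult_def.

Lemma ulim_le a b : (ulim a <= ulim b) = `[< \forall e \near U, a e <= b e >].
Proof. exact: uleE. Qed.

Lemma ulim_lt a b : (ulim a < ulim b) = `[< \forall e \near U, a e < b e >].
Proof. exact: ultE. Qed.

Lemma ulim_norm a : `|ulim a| = ulim (fun e => `|a e|).
Proof. exact: unormE. Qed.

End Ultrapower.

Section Residue.
Variable K : numFieldType.

Definition finite_pred : {pred K} :=
  fun z => `[< exists2 n : nat, (0 < n)%N & `|z| <= n%:R >].

Lemma finite_subring : subring_closed finite_pred.
Proof.
split.
- by apply/asboolP; exists 1%N; rewrite ?normr1.
- move=> x y /asboolP[n n0 xn] /asboolP[m m0 ym]; apply/asboolP.
  exists (n + m)%N; first by rewrite addn_gt0 n0.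
  by rewrite natrD (le_trans (ler_normB _ _))// lerD.
- move=> x y /asboolP[n n0 xn] /asboolP[m m0 ym]; apply/asboolP.
  by exists (n * m)%N; rewrite ?muln_gt0 ?n0// natrM normrM ler_pM.
Qed.

HB.instance Definition _ := GRing.isSubringClosed.Build K finite_pred finite_subring.

Definition finite_num := {z : K | z \in finite_pred}.

HB.instance Definition _ := SubType.on finite_num.
HB.instance Definition _ := Choice.on finite_num.
HB.instance Definition _ :=
  [SubChoice_isSubComNzRing of finite_num by <:].

Definition infinitesimal : {pred finite_num} :=
  fun z => `[< forall n : nat, (0 < n)%N -> `|val z| < n%:R^-1 >].

Lemma infinitesimal_ideal : idealr_closed infinitesimal.
Proof.
split.
- by apply/asboolP => n n0; rewrite raddf0 normr0 invr_gt0 ltr0n.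
- by apply/asboolP => /(_ 1%N isT); rewrite rmorph1 normr1 invr1 ltxx.
- move=> a u v /asboolP u0 /asboolP v0; apply/asboolP => n n0.
  have /asboolP[m m0 am] := valP a.
  have -> : (n%:R^-1 : K) = m%:R * (m * (n + n))%:R^-1 + (n + n)%:R^-1.
    have nn : n%:R != 0 :> K by rewrite pnatr_eq0 -lt0n.
    have mn : m%:R != 0 :> K by rewrite pnatr_eq0 -lt0n.
    rewrite natrM natrD; field; rewrite nn mn /= -natrD pnatr_eq0 -lt0n.
    by rewrite addn_gt0 n0.
  rewrite rmorphD rmorphM (le_lt_trans (ler_normD _ _))// normrM ler_ltD//.
    apply: ler_pM => //; apply/ltW/u0; by rewrite muln_gt0 m0 addn_gt0 n0.
  by apply: v0; rewrite addn_gt0 n0.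
Qed.

HB.instance Definition _ :=
  isIdealr.Build finite_num infinitesimal infinitesimal_ideal.

Definition residue : Type := {ideal_quot infinitesimal}.

HB.instance Definition _ := GRing.ComNzRing.on residue.
HB.instance Definition _ := NzRingQuotient.on residue.

Lemma residue_eq (x y : finite_num) :
  (\pi_residue x == \pi_residue y) = (x - y \in infinitesimal).
Proof. by rewrite Quotient.idealrBE. Qed.

Lemma residue_eq0 (x : finite_num) : (\pi_residue x == 0) = (x \in infinitesimal).
Proof. by rewrite -(rmorph0 \pi_residue) residue_eq subr0. Qed.

Lemma finite_inv (x : finite_num) :
  x \notin infinitesimal -> (val x)^-1 \in finite_pred.
Proof.
move=> /asboolPn /existsNP[n /not_implyP[n0 /negP xn]].
apply/asboolP; exists n => //; rewrite normfV.
have xn' : n%:R^-1 <= `|val x|.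
  by rewrite real_leNgt ?realV ?realn ?normr_real.
rewrite -[leRHS]invrK lef_pV2 // posrE ?invr_gt0 ?ltr0n //.
by apply: lt_le_trans xn'; rewrite invr_gt0 ltr0n.
Qed.

Definition rinv (p : residue) : residue :=
  if p == 0 then 0 else \pi_residue (insubd 0 (val (repr p))^-1).

Lemma rmulVr p : p != 0 -> rinv p * p = 1.
Proof.
move=> p0; rewrite /rinv (negPf p0) -{2}(reprK p) -rmorphM.
have xI : repr p \notin infinitesimal by rewrite -residue_eq0 reprK.
rewrite -(rmorph1 \pi_residue); congr (\pi_residue _); apply: val_inj.
transitivity (val (insubd (0 : finite_num) (val (repr p))^-1) * val (repr p)) => //.
rewrite insubdK ?finite_inv// mulVf //.
apply: contra xI => /eqP x0; apply/asboolP => n n0.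
by rewrite x0 normr0 invr_gt0 ltr0n.
Qed.

Lemma rinv0 : rinv 0 = 0.
Proof. by rewrite /rinv eqxx. Qed.

HB.instance Definition _ := GRing.ComNzRing_isField.Build residue rmulVr rinv0.

End Residue.

Lemma lt_perturb (K : realFieldType) (x y a b d : K) :
  `|a - x| < d -> `|b - y| < d -> d + d <= `|x - y| -> (a < b) = (x < y).
Proof.
rewrite 2!ltr_norml => /andP[? ?] /andP[? ?].
have [yx|xy] := leP y x.
  by rewrite ger0_norm ?subr_ge0// => H; apply/negbTE; rewrite -leNgt; lra.
by rewrite ltr0_norm ?subr_lt0// => H; lra.
Qed.

Section RealResidue.
Variable K : realFieldType.

Implicit Types (x y : finite_num K) (p q : residue K).

(* [x] < [y] iff x < y and x - y is not infinitesimal; see residue_lt for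
   arbitrary representatives x, y *)
Definition rlt p q :=
  (val (repr p) < val (repr q)) && (repr p - repr q \notin @infinitesimal K).
Definition rle p q := (p == q) || rlt p q.
Definition rnorm p := if rle 0 p then p else - p.

Lemma rltE x y : rlt (\pi_(residue K) x) (\pi_(residue K) y) =
  (val x < val y) && (x - y \notin @infinitesimal K).
Proof.
rewrite /rlt -!residue_eq !reprK residue_eq.
have [xy|/asboolPn/existsNP[n /not_implyP[n0]]] := boolP (x - y \in _).
  by rewrite !andbF.
rewrite !andbT rmorphB /= => xyn.
have close z : `|val (repr (\pi_(residue K) z)) - val z| < (n + n)%:R^-1.
  have : repr (\pi_(residue K) z) - z \in @infinitesimal K.
    by rewrite -residue_eq reprK.
  by move/asboolP => /(_ (n + n)%N); rewrite rmorphB /=; apply; rewrite addn_gt0 n0.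
have half : (n%:R^-1 : K) = (n + n)%:R^-1 + (n + n)%:R^-1.
  have nn : n%:R != 0 :> K by rewrite pnatr_eq0 -lt0n.
  by rewrite natrD; field; rewrite nn /= -natrD pnatr_eq0 -lt0n addn_gt0 n0.
apply: (lt_perturb (close x) (close y)).
by rewrite -half leNgt; apply/negP.
Qed.

Lemma rlt0_add p q : rlt 0 p -> rlt 0 q -> rlt 0 (p + q).
Proof.
rewrite -(reprK p) -(reprK q); set x := repr p; set y := repr q.
rewrite -rmorphD -(rmorph0 \pi_(residue K)) !rltE !sub0r !rpredN.
move=> /andP[x0 xI] /andP[y0 yI]; rewrite rmorphD addr_gt0//=.
apply: contra xI => /asboolP xyI; apply/asboolP => n n0.
apply: le_lt_trans (xyI n n0); rewrite rmorphD /= !gtr0_norm ?addr_gt0//.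
by rewrite lerDl ltW.
Qed.

Lemma rlt0_mul p q : rlt 0 p -> rlt 0 q -> rlt 0 (p * q).
Proof.
move=> p0 q0; have : p * q != 0.
  by rewrite mulf_neq0//; [move: p0|move: q0]; apply: contraTneq => ->;
    rewrite /rlt ltxx.
move: p0 q0; rewrite -(reprK p) -(reprK q); set x := repr p; set y := repr q.
rewrite -rmorphM -(rmorph0 \pi_(residue K)) residue_eq !rltE !sub0r !rpredN subr0.
by move=> /andP[x0 xI] /andP[y0 yI] ->; rewrite rmorphM mulr_gt0.
Qed.

Lemma rlt0_ngt0 p : rlt 0 p -> ~~ rlt p 0.
Proof. by move=> /andP[p0 _]; rewrite /rlt negb_and -leNgt ltW. Qed.

Lemma rsub_gt0 p q : rlt 0 (q - p) = rlt p q.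
Proof.
rewrite -(reprK p) -(reprK q); set x := repr p; set y := repr q.
rewrite -rmorphB -(rmorph0 \pi_(residue K)) !rltE sub0r opprB.
by rewrite rmorphB subr_gt0.
Qed.

Lemma rlt0_total p : p != 0 -> rlt 0 p || rlt p 0.
Proof.
rewrite -(reprK p); set x := repr p.
rewrite -(rmorph0 \pi_(residue K)) residue_eq !rltE sub0r subr0 rpredN => xI.
rewrite xI !andbT -neq_lt eq_sym; apply: contra xI => /eqP x0.
by apply/asboolP => n n0; rewrite x0 normr0 invr_gt0 ltr0n.
Qed.

Lemma rnormN p : rnorm (- p) = rnorm p.
Proof.
rewrite /rnorm /rle ![0 == _]eq_sym oppr_eq0.
have [->|p0] /= := eqVneq p 0; first by rewrite oppr0.
have E : rlt 0 (- p) = rlt p 0 by rewrite -[in LHS](add0r (- p)) rsub_gt0.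
rewrite E; have := rlt0_total p0; have := @rlt0_ngt0 p.
by case: (rlt 0 p); case: (rlt p 0); rewrite ?opprK// => /(_ isT).
Qed.

Lemma rge0_norm p : rle 0 p -> rnorm p = p.
Proof. by rewrite /rnorm => ->. Qed.

Lemma rle_def p q : rle p q = (p == q) || rlt p q.
Proof. by []. Qed.

HB.instance Definition _ := Num.IntegralDomain_isLtReal.Build (residue K)
  rlt0_add rlt0_mul rlt0_ngt0 rsub_gt0 rlt0_total rnormN rge0_norm rle_def.

Lemma residue_lt x y : (\pi_(residue K) x < \pi_(residue K) y) =
  (val x < val y) && (x - y \notin @infinitesimal K).
Proof. exact: rltE. Qed.

End RealResidue.

Section Hyper.
Variables (R : realType) (U : set_system {posnum R}).
Hypothesis HU : UltraFilter U.

Definition hyperC := ultrapower R[i] HU.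
HB.instance Definition _ := Num.NumField.on hyperC.

Definition hreal_pred : {pred hyperC} := fun z =>
  `[< exists2 a : {posnum R} -> R[i],
        z = ulim HU a & \forall e \near U, complex.Im (a e) = 0 >].

Lemma hreal_divring : divring_closed hreal_pred.
Proof.
split.
- by apply/asboolP; exists (fun=> 1); [exact: ulim1|exact: filterE].
- move=> _ _ /asboolP[a -> a0] /asboolP[b -> b0]; apply/asboolP.
  exists (fun e => a e - b e); first by rewrite ulimN ulimD.
  by move: a0 b0; apply: filterS2 => e; case: (a e) (b e) => [? ?] [? ?] /= -> ->;
    rewrite subr0.
- move=> _ _ /asboolP[a -> a0] /asboolP[b -> b0]; apply/asboolP.
  exists (fun e => a e / b e).
    by rewrite -ulimM; congr (_ * _); exact: uinvE.
  move: a0 b0; apply: filterS2 => e; case: (a e) (b e) => [? ?] [? ?] /= -> ->.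
  by rewrite mul0r oppr0 mulr0 mul0r addr0.
Qed.

HB.instance Definition _ := GRing.isDivringClosed.Build hyperC hreal_pred hreal_divring.

(* classes of nets that are real a.e., as a subfield of hyperC *)
Definition hyperR := {z : hyperC | z \in hreal_pred}.
HB.instance Definition _ := SubType.on hyperR.
HB.instance Definition _ := Choice.on hyperR.
HB.instance Definition _ := [SubChoice_isSubIntegralDomain of hyperR by <:].
HB.instance Definition _ := [SubIntegralDomain_isSubField of hyperR by <:].


Implicit Types x y : hyperR.

Lemma hreal_norm (z : hyperC) : `|z| \in hreal_pred.
Proof.
have [a ->] := ulimP z; apply/asboolP; exists (fun e => `|a e|).
  exact: ulim_norm.
by apply: filterE => e; case: (a e).
Qed.

Lemma hreal_ge0_or_le0 (z : hyperC) : z \in hreal_pred -> (0 <= z) || (z <= 0).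
Proof.
move=> /asboolP[a -> a0]; rewrite /hyperC ulim0 !ulim_le; apply/orP.
have [H|/nearN H] := pselect (\forall e \near U, 0 <= a e).
  by left; apply/asboolP.
right; apply/asboolP; move: a0 H; apply: filterS2 => e.
by case: (a e) => u v /= ->; rewrite !lecE /= !eqxx /= => /negP; rewrite -ltNge => /ltW.
Qed.

Definition hrle x y := val x <= val y.
Definition hrlt x y := val x < val y.
Definition hrnorm x : hyperR := Sub `|val x| (hreal_norm (val x)).

Lemma hrle0_add x y : hrle 0 x -> hrle 0 y -> hrle 0 (x + y).
Proof. exact: addr_ge0. Qed.

Lemma hrle0_mul x y : hrle 0 x -> hrle 0 y -> hrle 0 (x * y).
Proof. exact: mulr_ge0. Qed.

Lemma hrle0_anti x : hrle 0 x -> hrle x 0 -> x = 0.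
Proof. by move=> x0 x1; apply/val_inj/le_anti/andP; split. Qed.

Lemma hrsub_ge0 x y : hrle 0 (y - x) = hrle x y.
Proof. exact: subr_ge0. Qed.

Lemma hrle0_total x : hrle 0 x || hrle x 0.
Proof. exact: (hreal_ge0_or_le0 (valP x)). Qed.

Lemma hrnormN x : hrnorm (- x) = hrnorm x.
Proof. by apply: val_inj; exact: normrN. Qed.

Lemma hrge0_norm x : hrle 0 x -> hrnorm x = x.
Proof. by move=> x0; apply: val_inj; exact: ger0_norm. Qed.

Lemma hrlt_def x y : hrlt x y = (y != x) && hrle x y.
Proof. exact: lt_def. Qed.

HB.instance Definition _ := Num.IntegralDomain_isLeReal.Build hyperR
  hrle0_add hrle0_mul hrle0_anti hrsub_ge0 hrle0_total hrnormN hrge0_norm hrlt_def.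

Lemma hreal_const (a : {posnum R} -> R) :
  ulim HU (fun e => (a e)%:C) \in hreal_pred.
Proof. by apply/asboolP; exists (fun e => (a e)%:C) => //; exact: filterE. Qed.

Definition hyperR_of_net (a : {posnum R} -> R) : hyperR :=
  Sub (ulim HU (fun e => (a e)%:C)) (hreal_const a).

Lemma hyperR_lt (a b : {posnum R} -> R) :
  (hyperR_of_net a < hyperR_of_net b) = `[< \forall e \near U, a e < b e >].
Proof.
transitivity (`[< \forall e \near U, (a e)%:C < (b e)%:C >]).
  exact: (ulim_lt HU (fun e => (a e)%:C) (fun e => (b e)%:C)).
by apply/asboolP/asboolP; apply: filterS => e; rewrite ltcR.
Qed.

Definition hyperR_cst (r : R) : hyperR := hyperR_of_net (fun=> r).

Definition hRe (z : hyperC) : hyperR := hyperR_of_net (fun e => complex.Re (repr z e)).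
Definition hIm (z : hyperC) : hyperR := hyperR_of_net (fun e => complex.Im (repr z e)).
Definition hyperi : hyperC := ulim HU (fun=> 'i%C).

Lemma hyperDiM (a b : {posnum R} -> R[i]) :
  (ulim HU a : hyperC) + hyperi * (ulim HU b : hyperC) =
  ulim HU (fun e => a e + 'i%C * b e).
Proof.
by have := ulimD HU a (fun e => 'i%C * b e); rewrite -ulimM.
Qed.

Lemma hyper_ReIm z : z = val (hRe z) + hyperi * val (hIm z).
Proof.
rewrite [RHS]hyperDiM -[LHS]ulim_repr.
by congr (ulim _ _); apply/funext => e; exact: complexE.
Qed.

Lemma hyper_ReIm_uniq x y z :
  z = val x + hyperi * val y -> x = hRe z /\ y = hIm z.
Proof.
case: x y => x xr [y yr] /=; have /asboolP[a ax a0] := xr.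
have /asboolP[b bx b0] := yr; subst x y => ->.
rewrite hyperDiM; split; apply: val_inj; apply/ulim_eq;
  move: a0 b0 (near_repr HU (fun e => a e + 'i%C * b e));
  apply: filterS3 => e a0 b0 ->; move: a0 b0;
  by case: (a e) (b e) => [u ?] [v ?] /= -> ->; simpc.
Qed.

(* meaningful for finite x, where the set is nonempty and bounded above *)
Definition stR x : R := sup [set r : R | hyperR_cst r <= x].

Definition stC (z : hyperC) : R[i] := stR (hRe z) +i* stR (hIm z).

End Hyper.

(* Main.v *)
(* The constant nets embed the standard field into the finite numbers, and a
   finite real x differs from the constant st x by an infinitesimal, because
   for every n > 0 some r <= x exceeds st x - 1/n while st x + 1/n <= x fails.
   Hence the field morphism sending a constant to its coset is onto, and its
   inverse is [z] |-> st z.  The order is preserved for algebraic reasons: a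
   bijective morphism onto a real closed field pulls nonnegative elements, which
   are squares, back to squares. *)
Require Import Defs.
From HB Require Import structures.
From mathcomp Require Import all_boot all_order all_algebra.
From mathcomp Require Import interval_inference.
From mathcomp Require Import boolp classical_sets functions filter reals.
From mathcomp Require Import complex lra.

Set Implicit Arguments.
Unset Strict Implicit.
Unset Printing Implicit Defensive.

Import Order.TTheory GRing.Theory Num.Theory.

Local Open Scope ring_scope.
Local Open Scope quotient_scope.
Local Open Scope classical_set_scope.
Local Open Scope complex_scope.

(** If [f x] is nonnegative, the preimage of its square root squares to [x], so [f] reflects
    nonnegativity and hence the order. *)
Lemma bij_rmorph_lt_mono (F : realFieldType) (G : rcfType)
    (f : {rmorphism F -> G}) :
  bijective f -> {mono f : x y / x < y}.
Proof.
move=> [g fK gK].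
have f_reflects x : 0 <= f x -> 0 <= x.
  move=> /sqr_sqrtr fx; have -> : x = g (Num.sqrt (f x)) ^+ 2.
    by apply: (can_inj fK); rewrite rmorphXn /= gK.
  exact: sqr_ge0.
have f_le x y : f x <= f y -> x <= y.
  by rewrite -subr_ge0 -rmorphB => /f_reflects; rewrite subr_ge0.
apply: leW_mono => x y; apply/idP/idP => [/f_le//|xy].
rewrite leNgt; apply/negP => fyx.
(* By totality, reflection suffices: [f y < f x] would give [y <= x], hence [x = y], which is
   absurd. *)
by have xyE : x = y; [apply/le_anti; rewrite xy f_le// ltW|rewrite xyE ltxx in fyx].
Qed.

(** * Standard part isomorphisms, for real and complex constants at once *)

Section StandardPart.
Variables (K : numFieldType) (F : fieldType) (c : {rmorphism F -> K}).
Variable st : K -> F.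
Hypothesis c_finite : forall a, c a \in @finite_pred K.
Hypothesis st_close : forall z, z \in @finite_pred K ->
  forall n : nat, (0 < n)%N -> `|z - c (st z)| < n%:R^-1.

Definition finite_const (a : F) : finite_num K := Sub (c a) (c_finite a).

Lemma finite_const_zmod : zmod_morphism finite_const.
Proof. by move=> a b; apply: val_inj; rewrite /= rmorphB. Qed.

Lemma finite_const_monoid : monoid_morphism finite_const.
Proof.
split=> [|a b]; apply: val_inj; rewrite /= ?rmorph1 ?rmorphM//.
Qed.

HB.instance Definition _ :=
  GRing.isZmodMorphism.Build F (finite_num K) finite_const finite_const_zmod.
HB.instance Definition _ :=
  GRing.isMonoidMorphism.Build F (finite_num K) finite_const finite_const_monoid.

Definition residue_const : F -> residue K := \pi_(residue K) \o finite_const.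
HB.instance Definition _ := GRing.RMorphism.on residue_const.

Lemma residue_const_st (z : finite_num K) :
  residue_const (st (val z)) = \pi_(residue K) z.
Proof.
apply/esym/eqP; rewrite /residue_const /= residue_eq; apply/asboolP => n n0.
by rewrite rmorphB /=; apply: st_close (valP z) n n0.
Qed.

Definition residue_st (p : residue K) : F := st (val (repr p)).

Lemma residue_stK : cancel residue_st residue_const.
Proof. by move=> p; rewrite residue_const_st reprK. Qed.

(** A ring morphism out of a field is injective, so its right inverse is two-sided. *)
Lemma residue_constK : cancel residue_const residue_st.
Proof. by move=> a; apply: (fmorph_inj residue_const); exact: residue_stK. Qed.

(** Independence of the representative: the injective [residue_const] sends both sides to the coset
    of [z]. *)
Lemma residue_st_pi z : residue_st (\pi_(residue K) z) = st (val z).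
Proof.
apply: (fmorph_inj residue_const).
exact: etrans (residue_stK _) (esym (residue_const_st z)).
Qed.

(** As the inverse of a bijective morphism, [residue_st] is a morphism; sums and products of
    standard parts need no computation. *)
HB.instance Definition _ := GRing.isZmodMorphism.Build (residue K) F residue_st
  (can2_zmod_morphism residue_constK residue_stK).
HB.instance Definition _ := GRing.isMonoidMorphism.Build (residue K) F residue_st
  (can2_monoid_morphism residue_constK residue_stK).

Lemma residue_st_iso : exists f : {rmorphism residue K -> F},
  bijective f /\ forall z : finite_num K, f (\pi_(residue K) z) = st (val z).
Proof.
exists residue_st; split; last exact: residue_st_pi.
by exists residue_const; [exact: residue_stK|exact: residue_constK].
Qed.

End StandardPart.

Lemma ulimB (T : pointedType) (K : numFieldType) (U : set_system T)
    (HU : UltraFilter U) (a b : T -> K) :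
  ulim HU (fun e => a e - b e) = ulim HU a - ulim HU b.
Proof. by rewrite ulimN ulimD. Qed.

(** * Constants and standard parts in the hyperreal and hypercomplex fields *)

Section Hyperreal.
Variables (R : realType) (U : set_system {posnum R}) (HU : UltraFilter U).

Lemma hyperR_cst_zmod : zmod_morphism (hyperR_cst HU).
Proof.
move=> a b; apply: val_inj; apply: etrans (ulimB _ _ _).
by congr (ulim _ _); apply/funext => e; rewrite rmorphB.
Qed.

Lemma hyperR_cst_monoid : monoid_morphism (hyperR_cst HU).
Proof.
split=> [|a b]; apply: val_inj; first exact/esym/ulim1.
apply: etrans (esym (ulimM _ _ _)).
by congr (ulim _ _); apply/funext => e; rewrite rmorphM.
Qed.

HB.instance Definition _ :=
  GRing.isZmodMorphism.Build R (hyperR HU) (hyperR_cst HU) hyperR_cst_zmod.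
HB.instance Definition _ :=
  GRing.isMonoidMorphism.Build R (hyperR HU) (hyperR_cst HU) hyperR_cst_monoid.

Lemma hyperR_cst_lt : {mono hyperR_cst HU : r s / r < s}.
Proof.
move=> r s; rewrite hyperR_lt; apply/asboolP/idP => [|rs]; last exact: filterE.
(* A set in a proper filter is nonempty, and the compared constants do not depend on the index. *)
by move=> /filter_ex[].
Qed.

Lemma hyperR_cst_le : {mono hyperR_cst HU : r s / r <= s}.
Proof. by apply: le_mono => r s; rewrite hyperR_cst_lt. Qed.

Lemma hyperR_cst_finite r : hyperR_cst HU r \in @finite_pred (hyperR HU).
Proof.
apply/asboolP; exists (Num.truncn `|r|).+1 => //.
rewrite -(rmorph_nat (hyperR_cst HU)) ler_norml -rmorphN !hyperR_cst_le.
by rewrite -ler_norml ltW// truncnS_gt.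
Qed.

Lemma stR_close (x : hyperR HU) : x \in @finite_pred (hyperR HU) ->
  forall n : nat, (0 < n)%N -> `|x - hyperR_cst HU (stR x)| < n%:R^-1.
Proof.
move=> /asboolP[m m0]; rewrite ler_norml -(rmorph_nat (hyperR_cst HU)) -rmorphN.
move=> /andP[mx xm] n n0; set S := [set r : R | hyperR_cst HU r <= x].
have n_gt0 : 0 < n%:R^-1 :> R by rewrite invr_gt0 ltr0n.
(* The bounds [-m <= x <= m] make [S] nonempty and bounded above, so [sup S] is a genuine supremum
   and not a default value. *)
have S_sup : has_sup S.
  split; first by exists (- m%:R).
  by exists m%:R => r rx; rewrite -hyperR_cst_le (le_trans rx).
have xlt : x < hyperR_cst HU (stR x + n%:R^-1).
  rewrite ltNge; apply/negP => xS; have := sup_ubound (proj2 S_sup) xS.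
  by rewrite leNgt ltrDl n_gt0.
have [r rS rgt] := sup_adherent n_gt0 S_sup.
have gtx : hyperR_cst HU (stR x - n%:R^-1) < x.
  by apply: lt_le_trans rS; rewrite hyperR_cst_lt.
rewrite -(rmorph_nat (hyperR_cst HU)) -fmorphV ltr_norml ltrBlDl.
by rewrite -rmorphD xlt ltrBrDl -rmorphB gtx.
Qed.

Definition hyperC_cst (a : R[i]) : hyperC HU := ulim HU (fun=> a).

Lemma hyperC_cst_zmod : zmod_morphism hyperC_cst.
Proof. by move=> a b; exact: etrans (ulimB _ _ _). Qed.

Lemma hyperC_cst_monoid : monoid_morphism hyperC_cst.
Proof. by split=> [|a b]; [exact/esym/ulim1|exact: etrans (esym (ulimM _ _ _))]. Qed.

HB.instance Definition _ :=
  GRing.isZmodMorphism.Build R[i] (hyperC HU) hyperC_cst hyperC_cst_zmod.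
HB.instance Definition _ :=
  GRing.isMonoidMorphism.Build R[i] (hyperC HU) hyperC_cst hyperC_cst_monoid.

Lemma hyperC_cst_ReIm a : hyperC_cst a =
  val (hyperR_cst HU (complex.Re a)) +
  hyperi HU * val (hyperR_cst HU (complex.Im a)).
Proof.
rewrite [RHS]hyperDiM; congr (ulim _ _).
by apply/funext => e; exact: complexE.
Qed.

Lemma hyperi_norm : `|hyperi HU| = 1.
Proof.
rewrite [LHS]ulim_norm [RHS]ulim1; congr (ulim _ _); apply/funext => e.
by rewrite normc_def /= expr0n expr1n add0r sqrtr1.
Qed.

(** The triangle inequality reduces bounds on a hypercomplex modulus to bounds on two hyperreals. *)
Lemma norm_ReIm_le (x y : hyperR HU) :
  `|val x + hyperi HU * val y| <= val (`|x| + `|y|).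
Proof.
by rewrite (le_trans (ler_normD _ _))// normrM hyperi_norm mul1r.
Qed.

Lemma hRe_norm_le (z : hyperC HU) : val `|hRe z| <= `|z|.
Proof.
rewrite -{2}[z]ulim_repr [leLHS]ulim_norm [leRHS]ulim_norm ulim_le.
apply/asboolP/filterE => e; case: (repr z e) => a b /=.
rewrite !normc_def /= lecR expr0n addr0 ler_wsqrtr// lerDl sqr_ge0//.
Qed.

Lemma hIm_norm_le (z : hyperC HU) : val `|hIm z| <= `|z|.
Proof.
rewrite -{2}[z]ulim_repr [leLHS]ulim_norm [leRHS]ulim_norm ulim_le.
apply/asboolP/filterE => e; case: (repr z e) => a b /=.
rewrite !normc_def /= lecR expr0n addr0 ler_wsqrtr// lerDr sqr_ge0//.
Qed.

Lemma hyperR_val_nat n : val (n%:R : hyperR HU) = n%:R.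
Proof. by rewrite rmorph_nat. Qed.

(** Passes finiteness from [z] to its real and imaginary parts, so that [stR_close] applies to
    them. *)
Lemma finite_hreal (x : hyperR HU) (z : hyperC HU) :
  val `|x| <= `|z| -> z \in @finite_pred (hyperC HU) ->
  x \in @finite_pred (hyperR HU).
Proof.
move=> xz /asboolP[n n0 zn]; apply/asboolP; exists n => //.
by apply: (le_trans xz); rewrite hyperR_val_nat.
Qed.

Lemma hyperC_cst_finite a : hyperC_cst a \in @finite_pred (hyperC HU).
Proof.
have /asboolP[m m0 am] := hyperR_cst_finite (complex.Re a).
have /asboolP[n n0 bn] := hyperR_cst_finite (complex.Im a).
apply/asboolP; exists (m + n)%N; first by rewrite addn_gt0 m0.
rewrite hyperC_cst_ReIm (le_trans (norm_ReIm_le _ _))//.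
by rewrite -hyperR_val_nat natrD; exact: lerD am bn.
Qed.

Lemma stC_close (z : hyperC HU) : z \in @finite_pred (hyperC HU) ->
  forall n : nat, (0 < n)%N -> `|z - hyperC_cst (stC z)| < n%:R^-1.
Proof.
move=> zf n n0.
(* Each part gets the error bound [1/(2n)], so that the two add up to [1/n]. *)
have n2 : (0 < 2 * n)%N by rewrite muln_gt0.
have reC := stR_close (finite_hreal (hRe_norm_le z) zf) n2.
have imC := stR_close (finite_hreal (hIm_norm_le z) zf) n2.
rewrite {1}[z]hyper_ReIm hyperC_cst_ReIm opprD addrACA -mulrBr -!rmorphB.
apply: le_lt_trans (norm_ReIm_le _ _) _.
(* With [1/n] written as the value of a hyperreal, the inequality becomes one in the ordered field
   [hyperR HU]. *)
rewrite -hyperR_val_nat -fmorphV.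
suff: n%:R^-1 = (2 * n)%:R^-1 + (2 * n)%:R^-1 :> hyperR HU.
  by move=> ->; exact: ltrD reC imC.
by rewrite natrM invfM -mulrDl; lra.
Qed.

End Hyperreal.

Theorem theorem2p7p4 (R : realType) (U : set_system {posnum R})
    (HU : UltraFilter U)
    (Usmall : forall n : nat, (0 < n)%N ->
      U [set e : {posnum R} | e%:num < n%:R^-1]) :
  (exists f : {rmorphism residue (hyperC HU) -> R[i]},
     bijective f /\
     forall z : finite_num (hyperC HU),
       f (\pi_(residue (hyperC HU)) z) = stC (val z)) /\
  (exists f : {rmorphism residue (hyperR HU) -> R},
     [/\ bijective f,
         {mono f : p q / p < q} &
         forall x : finite_num (hyperR HU),
           f (\pi_(residue (hyperR HU)) x) = stR (val x)]).
Proof.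
split.
  exact: (residue_st_iso (c := @hyperC_cst R U HU)
    (@hyperC_cst_finite R U HU) (@stC_close R U HU)).
have [f [f_bij fE]] := residue_st_iso (c := @hyperR_cst R U HU)
  (@hyperR_cst_finite R U HU) (@stR_close R U HU).
by exists f; split=> //; exact: bij_rmorph_lt_mono.
Qed.
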